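(* Let $G=G[X,Y]$ be a bipartite graph with $n$ vertices and $m$ edges and with bipartition $(X,Y)$. Assume $|X|=r$, $|Y|=s$, $r\leq s$ and $m\leq\frac{1}{2}rs$. Then $$\max\{0,\, r-m\}\leq\kappa(G)+\kappa(G^{bc})\leq N(n,m)$$ and $$0\leq \kappa(G)\,\kappa(G^{bc})\leq M(n,m),$$ where $$N(n,m)=\begin{cases} r-2, & \text{if } s+1\leq m\leq n-2,\\ r-1, & \text{if } 1\leq m\leq s,\ \text{or } (m=n-1 \text{ and } r\geq 2),\ \text{or } (m\not\equiv 0 \ (\mathrm{mod}\ s) \text{ and } m\geq n),\\ r, & \text{otherwise,}\end{cases}$$ and $$M(n,m)=\begin{cases} 0, & \text{if } m\leq n-2,\ \text{or } (m=n-1 \text{ and } r=1),\\ \frac{m}{s}\left(r-\frac{m}{s}\right), & \text{if } m\equiv 0\ (\mathrm{mod}\ s) \text{ and } m\geq n,\\ \left\lfloor\frac{m}{s}\right\rfloor\left(r-1-\left\lfloor\frac{m}{s}\right\rfloor\right), & \text{otherwise.}\end{cases}$$ Furthermore, these bounds are best possible.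
   Context: All graphs are finite and simple. $G=G[X,Y]$ denotes a bipartite graph with a specified bipartition $(X,Y)$: every edge joins a vertex of $X$ to a vertex of $Y$. Its bipartite complementary graph $G^{bc}$ is the bipartite graph with $V(G^{bc})=V(G)$, the same bipartition $(X,Y)$, and $E(G^{bc})=\{xy: x\in X,\ y\in Y,\ xy\notin E(G)\}$. The vertex-connectivity $\kappa(H)$ of a graph $H$ is the minimum size of a vertex set $S$ such that $H-S$ is disconnected or has only one vertex. The quantities written $N(n,m)$ and $M(n,m)$ depend on $r$ and $s$ as well.
   Formalization: ''Best possible'' is proved as attainment for all admissible r, s, m, except that attainment of the upper bound N(n,m) is not claimed when r=2 and m=s: there G and its bipartite complement have s=n-2 edges each, so both are disconnected and the sum is 0, not r-1=1. *)

(* Defs.v *)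
From HB Require Import structures.
From mathcomp Require Import all_boot all_order all_algebra.

Set Implicit Arguments.
Unset Strict Implicit.
Unset Printing Implicit Defensive.

Record graph (V : finType) := Graph {
  adj :> rel V;
  adj_sym : symmetric adj;
  adj_irr : irreflexive adj }.

Definition edges (V : finType) (G : graph V) : {set {set V}} :=
  [set [set p.1; p.2] | p : V * V & G p.1 p.2].

Definition del (V : finType) (G : graph V) (S : {set V}) : rel V :=
  [rel u v | [&& u \notin S, v \notin S & G u v]].

(* S = setT is not a separator: the graph without vertices is neither
   disconnected nor a single vertex. *)
Definition separator (V : finType) (G : graph V) (S : {set V}) : bool :=
  [exists x in ~: S, exists y in ~: S, ~~ connect (del G S) x y]
  || (#|~: S| == 1).

(* The default value #|V| is reached only if V is empty (see kappaP). *)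
Definition kappa (V : finType) (G : graph V) : nat :=
  \big[minn/#|V|]_(S : {set V} | separator G S) #|S|.

Lemma kappa_min (V : finType) (G : graph V) (S : {set V}) :
  separator G S -> kappa G <= #|S|.
Proof.
move=> sS; rewrite /kappa; have := mem_index_enum S.
elim: (index_enum _) => // T ts IH; rewrite inE big_cons.
case/orP => [/eqP<-|/IH le_ts]; first by rewrite sS geq_minl.
by case: ifP => // _; apply: leq_trans (geq_minr _ _) le_ts.
Qed.

Lemma kappaP (V : finType) (G : graph V) :
  0 < #|V| -> exists2 S : {set V}, separator G S & #|S| = kappa G.
Proof.
case/card_gt0P => x _.
have sepx : separator G [set~ x] by rewrite /separator setCK cards1 eqxx orbT.
have : kappa G < #|V|.
  apply: leq_ltn_trans (kappa_min sepx) _.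
  by rewrite cardsC1 prednK //; apply/card_gt0P; exists x.
rewrite /kappa.
elim/big_rec: _ => [|S k sS IH]; first by rewrite ltnn.
have [leSk|ltkS] := leqP #|S| k; last exact: IH.
by exists S.
Qed.

Definition crossing (V : finType) (X Y : {set V}) (u v : V) : bool :=
  ((u \in X) && (v \in Y)) || ((u \in Y) && (v \in X)).

Record bigraph (V : finType) := Bigraph {
  bigraph_graph :> graph V;
  partX : {set V};
  partY : {set V};
  part_cover : partX :|: partY = [set: V];
  part_disjoint : [disjoint partX & partY];
  part_crossing : forall u v, bigraph_graph u v -> crossing partX partY u v }.

Section BipartiteComplement.
Variables (V : finType) (G : bigraph V).

Definition bc_adj : rel V :=
  [rel u v | crossing (partX G) (partY G) u v && ~~ G u v].

Lemma bc_adj_sym : symmetric bc_adj.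
Proof.
move=> u v; rewrite /bc_adj /crossing /= (adj_sym G u v) orbC.
by rewrite (andbC (v \in _)) (andbC (u \in partX G)).
Qed.

Lemma bc_adj_irr : irreflexive bc_adj.
Proof.
move=> u; rewrite /bc_adj /crossing /= (andbC (u \in partY G)) orbb.
by case: (boolP (u \in partX G)) => //= uX; rewrite (disjointFr (part_disjoint G)).
Qed.

Lemma bc_adj_crossing u v :
  Graph bc_adj_sym bc_adj_irr u v -> crossing (partX G) (partY G) u v.
Proof. by case/andP. Qed.

Definition bcompl : bigraph V :=
  @Bigraph V (Graph bc_adj_sym bc_adj_irr) (partX G) (partY G)
    (part_cover G) (part_disjoint G) bc_adj_crossing.

End BipartiteComplement.

Definition has_params (V : finType) (G : bigraph V) (r s n m : nat) : Prop :=
  [/\ #|partX G| = r, #|partY G| = s, #|V| = n & #|edges G| = m].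

Local Open Scope ring_scope.
Import GRing.Theory.

(* The conditions m <= n - 2 and m = n - 1 are written without the truncated
   subtraction of nat. For r = 2 and m = s the value r - 1 = 1 is not attained:
   G and its bipartite complement then both have s = n - 2 edges, so both are
   disconnected. *)
Definition Nbound (r s n m : nat) : rat :=
  if ((s + 1 <= m) && (m + 2 <= n))%N then r%:R - 2
  else if [|| (1 <= m <= s)%N,
              (m + 1 == n)%N && (2 <= r)%N
            | (m != 0 %[mod s])%N && (n <= m)%N] then r%:R - 1
  else r%:R.

Definition Mbound (r s n m : nat) : rat :=
  if ((m + 2 <= n) || ((m + 1 == n) && (r == 1)))%N then 0
  else if ((m == 0 %[mod s]) && (n <= m))%N
  then (m%:R / s%:R) * (r%:R - m%:R / s%:R)
  else (m %/ s)%N%:R * (r%:R - 1 - (m %/ s)%N%:R).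

(* Main.v *)
(* Upper bounds: kappa is at most every degree, so averaging over Y gives
   kappa(G) <= floor(m/s) and kappa(G^bc) <= r - ceil(m/s), and kappa(G) = 0
   when m <= n - 2 since a connected graph has at least n - 1 edges.

   Extremal graphs for the upper bounds: write m = qs + t with t < s, put
   X = Z/r, and join y_j to the interval of X starting at j mod r, of length
   q + 1 if j < t and q otherwise. In G^bc the neighbourhoods are intervals too.
   If every y_j is joined to an interval of length d >= 2, then kappa >= d:
   suppose that deleting A in X and B in Y separates the rest of X into P and Q.
   In Z/r the number of intervals meeting P is at least min(r, |P| + d - 1), and
   similarly for Q, while all intervals meeting both belong to B; as
   |P| + |Q| + |A| = r, this forces |A| + |B| >= d. For d = 1 connectedness comes from
   r - 1 consecutive intervals of length 2, which link X into a path. *)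

Require Import Defs.
From HB Require Import structures.
From mathcomp Require Import all_boot all_order all_algebra.
From mathcomp Require Import zify lra.

Import Order.TTheory GRing.Theory Num.Theory.

Set Implicit Arguments.
Unset Strict Implicit.
Unset Printing Implicit Defensive.

(** * Vertex-connectivity against degree, connectedness and number of edges *)

Section Connectivity.
Variables (V : finType) (G : graph V).

Lemma del0 : del G set0 =2 G.
Proof. by move=> x y; rewrite /del /= !inE. Qed.

Lemma connect_del_sym (S : {set V}) : connect_sym (del G S).
Proof.
apply: sym_connect_sym => x y; rewrite /del /= (adj_sym G x y).
by rewrite andbCA.
Qed.

(** Deleting the neighbours of [v] isolates it; if no other vertex is left, the second clause of
    [separator] applies. *)
Lemma kappa_le_degree (v : V) : kappa G <= #|[set u | G u v]|.
Proof.
apply: kappa_min; rewrite /separator.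
have vN : v \notin [set u | G u v] by rewrite inE adj_irr.
have [->|] := eqVneq (~: [set u | G u v]) [set v]; first by rewrite cards1 orbT.
rewrite eqEsubset sub1set in_setC vN andbT => /subsetPn[w wN].
rewrite inE => neq_wv; apply/orP; left.
apply/existsP; exists v; rewrite inE vN; apply/existsP; exists w; rewrite wN /=.
apply/connectP => -[[|u p] /=]; first by move=> _ eq_wv; rewrite eq_wv eqxx in neq_wv.
by rewrite /del /= !inE (adj_sym G v u) -!andbA => /and4P[_ /negbTE->].
Qed.

Lemma kappa_ge (k : nat) : 0 < #|V| ->
  (forall S : {set V}, #|S| < k -> ~~ separator G S) -> k <= kappa G.
Proof.
move=> V_gt0 nsep; have [S sepS <-] := kappaP G V_gt0.
by rewrite leqNgt; apply: contraL sepS => /nsep.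
Qed.

Lemma kappa_gt0_connect : 0 < kappa G -> forall x y, connect G x y.
Proof.
move=> k_gt0 x y; apply: contraTT k_gt0 => nxy; rewrite -leqNgt.
rewrite -(cards0 V); apply: kappa_min; rewrite /separator setC0; apply/orP; left.
apply/existsP; exists x; rewrite inE; apply/existsP; exists y; rewrite inE /=.
by rewrite (eq_connect del0).
Qed.

Lemma connect_kappa_gt0 : 1 < #|V| -> (forall x y, connect G x y) -> 0 < kappa G.
Proof.
move=> V_gt1 cG; apply: kappa_ge; first exact: ltnW.
move=> S; rewrite ltnS leqn0 cards_eq0 => /eqP->.
rewrite /separator setC0 cardsT gtn_eqF // orbF.
by apply/existsP => -[x /andP[_ /existsP[y /andP[_]]]]; rewrite (eq_connect del0) cG.
Qed.

Lemma connected_exit (A : {set V}) (x z : V) :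
  connect G x z -> x \in A -> z \notin A -> exists u v, [/\ u \in A, v \notin A & G u v].
Proof.
case/connectP => p; elim: p x => [|y p IHp] x /=.
  by move=> _ -> ->.
case/andP => Gxy yp ez xA zA; have [yA|yA] := boolP (y \in A); first exact: IHp yA zA.
by exists x, y.
Qed.

(** Grow a vertex set from one vertex, each time along an edge leaving it. That edge is not inside
    the old set, so k + 1 collected vertices span at least k edges. *)
Lemma connected_card_edges : (forall x y, connect G x y) -> #|V| <= #|edges G| + 1.
Proof.
move=> cG; have [->//|V_gt0] := posnP #|V|; have [x0 _] := card_gt0P V_gt0.
pose inside (A : {set V}) := [set e in edges G | e \subset A].
suff grow k : k < #|V| ->
    exists A : {set V}, [/\ x0 \in A, #|A| = k.+1 & k <= #|inside A|].
  have [|A [_ _ leA]] := grow #|V|.-1; first by rewrite prednK.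
  rewrite addn1 -(prednK V_gt0) ltnS (leq_trans leA) //.
  by apply/subset_leq_card/subsetP => e; rewrite inE => /andP[].
elim: k => [_|k IHk ltk].
  by exists [set x0]; rewrite inE eqxx cards1.
have [A [x0A cardA leA]] := IHk (ltnW ltk).
have [z zA] : exists z, z \notin A.
  have /card_gt0P[z] : 0 < #|~: A| by have := cardsC A; lia.
  by rewrite inE; exists z.
have [u [v [uA vA Guv]]] := connected_exit (cG x0 z) x0A zA.
exists (v |: A); rewrite !inE x0A orbT cardsU1 vA cardA; split => //.
have uvA : [set u; v] \notin inside A.
  rewrite inE negb_and orbC; apply/orP; left.
  by apply/subsetPn; exists v => //; rewrite !inE eqxx orbT.
suff /subset_leq_card : [set u; v] |: inside A \subset inside (v |: A).
  by rewrite cardsU1 uvA; apply: leq_trans.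
apply/subsetP => e; rewrite !inE => /orP[/eqP->|/andP[-> eA] /=].
  apply/andP; split; first by apply/imsetP; exists (u, v); rewrite ?inE.
  by apply/subsetP => w; rewrite !inE => /orP[]/eqP->; rewrite ?uA ?eqxx ?orbT.
by apply: subset_trans eA (subsetUr _ _).
Qed.

End Connectivity.

(** * Edge counting in a bipartite graph *)

Section BipartiteBounds.
Variables (V : finType) (G : bigraph V).

Definition arcs : {set V * V} :=
  [set p | [&& p.1 \in partX G, p.2 \in partY G & G p.1 p.2]].

Lemma partX_partY_false v : v \in partX G -> v \in partY G -> False.
Proof. by move=> vX; rewrite (disjointFr (part_disjoint G) vX). Qed.

Lemma partX_or_partY v : (v \in partX G) || (v \in partY G).
Proof. by rewrite -in_setU part_cover inE. Qed.

(** Disjointness of X and Y gives each edge exactly one orientation from X to Y; the ordered pairs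
    can then be counted by their end in Y. *)
Lemma card_edges : #|edges G| = #|arcs|.
Proof.
have -> : edges G = [set [set p.1; p.2] | p in arcs].
  apply/setP => e; apply/imsetP/imsetP => -[[x y]].
    rewrite inE /= => Gxy ->; case/orP: (part_crossing Gxy) => /andP[xP yP].
      by exists (x, y) => //; rewrite inE /= xP yP.
    by exists (y, x); rewrite ?inE /= ?xP ?yP ?(adj_sym G y x) // setUC.
  by rewrite inE /= => /and3P[_ _ Gxy] ->; exists (x, y); rewrite ?inE.
apply: card_in_imset => -[a b] [c d]; rewrite !inE /=.
move=> /and3P[aX bY _] /and3P[cX dY _] /setP eqS.
have := eqS a; rewrite !inE eqxx /= => /esym /orP[/eqP eac|/eqP ead]; last first.
  by case: (@partX_partY_false a) => //; rewrite ead.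
have := eqS b; rewrite !inE eqxx orbT /= => /esym /orP[/eqP ebc|/eqP ebd].
  by case: (@partX_partY_false b) => //; rewrite ebc.
by rewrite eac ebd.
Qed.

Lemma nbrY y : y \in partY G -> [set x | G x y] = [set x in partX G | G x y].
Proof.
move=> yY; apply/setP => x; rewrite !inE; case Gxy: (G x y); rewrite ?andbF // andbT.
case/orP: (part_crossing Gxy) => /andP[// xY yX].
by case: (@partX_partY_false y).
Qed.

Lemma card_arcs : #|arcs| = \sum_(y in partY G) #|[set x | G x y]|.
Proof.
rewrite -sum1_card (partition_big snd [in partY G]) => /=; last first.
  by move=> [x y]; rewrite inE => /and3P[].
apply: eq_bigr => y yY; rewrite nbrY // sum1_card.
rewrite -[RHS](@card_imset _ _ (pair^~ y)) => [|? ? [] //].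
apply: eq_card => -[x z]; rewrite unfold_in /= inE /=; apply/andP/imsetP.
  by case=> /and3P[xX _ Gxz] /eqP <-; exists x; rewrite // inE xX.
by case=> x'; rewrite inE => /andP[xX Gxy] [-> ->]; rewrite xX yY.
Qed.

Lemma kappa_mul_le : kappa G * #|partY G| <= #|edges G|.
Proof.
rewrite card_edges card_arcs mulnC -sum_nat_const.
by apply: leq_sum => y _; apply: kappa_le_degree.
Qed.

Lemma card_vertices : #|V| = #|partX G| + #|partY G|.
Proof.
rewrite -cardsT -(part_cover G); apply/eqP.
by rewrite (leq_card_setU (partX G) (partY G)) part_disjoint.
Qed.

Lemma kappa_eq0 : #|edges G| + 2 <= #|V| -> kappa G = 0.
Proof.
move=> le_mn; apply/eqP; rewrite -leqn0 leqNgt; apply/negP.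
by move/kappa_gt0_connect/connected_card_edges; lia.
Qed.

End BipartiteBounds.

(** * The bipartite complement and its connectivity from below *)

Section Complement.
Variables (V : finType) (G : bigraph V).

Lemma bcomplE x y : x \in partX G -> y \in partY G -> bcompl G x y = ~~ G x y.
Proof. by move=> xX yY; rewrite /= /bc_adj /crossing /= xX yY. Qed.

Lemma card_edges_bcompl : #|edges G| + #|edges (bcompl G)| = #|partX G| * #|partY G|.
Proof.
rewrite !card_edges -cardsX -(cardsID (arcs G) (setX _ _)); congr (_ + _).
  apply: eq_card => -[x y]; rewrite !inE /=.
  by case: (x \in _) => //; case: (y \in _) => //.
apply: eq_card => -[x y]; rewrite !inE /=.
case xX: (x \in _) => //; case yY: (y \in _) => //=; rewrite ?andbF //.
by rewrite andbT -(bcomplE xX yY).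
Qed.

Lemma card_nbr2 (u v : V) : u \in partX G -> v \in partX G ->
  #|[set y in partY G | G u y || G v y]| <= #|edges G|.
Proof.
move=> uX vX; rewrite card_edges; apply: leq_trans (leq_imset_card snd _).
apply/subset_leq_card/subsetP => y; rewrite inE => /andP[yY /orP[] Gy]; apply/imsetP.
  by exists (u, y); rewrite // inE /= uX yY.
by exists (v, y); rewrite // inE /= vX yY.
Qed.

(** After deleting fewer than r - m vertices, more than m remain on each side. Two vertices of X
    have at most m neighbours in total in G, so some remaining y is joined to both in the
    complement; likewise each remaining y has a non-neighbour left in X. *)
Lemma kappa_bcompl_ge : #|partX G| <= #|partY G| ->
  #|partX G| - #|edges G| <= kappa (bcompl G).
Proof.
move=> leXY; have [V0|V_gt0] := posnP #|V|; first by have := card_vertices G; lia.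
apply: kappa_ge => // S ltS; set H := bcompl G.
have cardXS : #|edges G| < #|partX G :\: S|.
  by have := cardsID S (partX G); have := subset_leq_card (subsetIr (partX G) S); lia.
have cardYS : #|edges G| < #|partY G :\: S|.
  by have := cardsID S (partY G); have := subset_leq_card (subsetIr (partY G) S); lia.
have delE x y : x \in partX G :\: S -> y \in partY G :\: S -> ~~ G x y ->
    connect (del H S) x y.
  move=> /setDP[xX xS] /setDP[yY yS] nGxy; apply: connect1.
  by rewrite /del /= xS yS /= /bc_adj /crossing /= xX yY.
have common u v : u \in partX G :\: S -> v \in partX G :\: S ->
    connect (del H S) u v.
  move=> uXS vXS.
  have /subsetPn[y yYS] :
    ~~ (partY G :\: S \subset [set y in partY G | G u y || G v y]).
    apply/negP => /subset_leq_card; apply/negP; rewrite -ltnNge.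
    by apply: leq_ltn_trans cardYS; apply: card_nbr2; [case/setDP: uXS | case/setDP: vXS].
  rewrite inE (setDP yYS).1 /= negb_or => /andP[nu nv].
  by apply: connect_trans (delE u y _ _ _) _; rewrite // connect_del_sym delE.
have toX y : y \in partY G :\: S ->
    exists2 x, x \in partX G :\: S & connect (del H S) x y.
  move=> yYS; have /subsetPn[x xXS] :
      ~~ (partX G :\: S \subset [set x | (x, y) \in arcs G]).
    apply/negP => /subset_leq_card; apply/negP; rewrite -ltnNge.
    apply: leq_ltn_trans cardXS; rewrite card_edges.
    rewrite -(@card_imset _ _ (pair^~ y)) => [|? ? [] //].
    by apply/subset_leq_card/subsetP => p /imsetP[z]; rewrite inE => zy ->.
  rewrite !inE /= (setDP xXS).1 (setDP yYS).1 /= => nG.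
  by exists x => //; apply: delE.
have to_X v : v \notin S -> exists2 x, x \in partX G :\: S & connect (del H S) x v.
  move=> vS; case/orP: (partX_or_partY G v) => vP; last by apply: toX; rewrite inE vS.
  by exists v => //; rewrite inE vS.
rewrite /separator negb_or; apply/andP; split.
  apply/existsP => -[u]; rewrite inE => /andP[uS /existsP[v]]; rewrite inE => /andP[vS].
  have [x xXS xu] := to_X u uS; have [y yXS yv] := to_X v vS.
  case/negP; apply: connect_trans yv; apply: connect_trans (common x y xXS yXS).
  by rewrite connect_del_sym.
have : #|partX G :\: S| + #|partY G :\: S| <= #|~: S|.
  have := cardsID (partX G) (~: S); rewrite setDE.
  have -> : ~: S :&: partX G = partX G :\: S by rewrite setDE setIC.
  have -> : ~: S :&: ~: partX G = partY G :\: S.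
    apply/setP => v; rewrite !inE; congr andb; apply/idP/idP => [nX|vY].
      by have := partX_or_partY G v; rewrite (negbTE nX).
    by apply/negP => vX; apply: (partX_partY_false vX vY).
  by move=> <-.
by lia.
Qed.

End Complement.

(** * Bipartite graphs built from a relation *)

Section BipartiteOfRelation.
Variables (I J : finType) (R : I -> J -> bool).

Definition rel_adj : rel (I + J) := fun u v =>
  match u, v with
  | inl i, inr j | inr j, inl i => R i j
  | _, _ => false
  end.

Lemma rel_adj_sym : symmetric rel_adj.
Proof. by move=> [i|j] [i'|j']. Qed.

Lemma rel_adj_irr : irreflexive rel_adj.
Proof. by move=> [i|j]. Qed.

Let lefts : {set I + J} := [set inl i | i in I].
Let rights : {set I + J} := [set inr j | j in J].

Lemma in_lefts u : (u \in lefts) = if u is inl _ then true else false.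
Proof.
case: u => [i|j]; first by apply/imsetP; exists i.
by apply/imsetP => -[].
Qed.

Lemma in_rights u : (u \in rights) = if u is inr _ then true else false.
Proof.
case: u => [i|j]; last by apply/imsetP; exists j.
by apply/imsetP => -[].
Qed.

Lemma lefts_rights_cover : lefts :|: rights = [set: I + J].
Proof. by apply/setP => -[i|j]; rewrite in_setU in_lefts in_rights inE. Qed.

Lemma lefts_rights_disjoint : [disjoint lefts & rights].
Proof.
by apply/pred0P => -[i|j] /=; rewrite in_lefts in_rights.
Qed.

Lemma rel_adj_crossing u v :
  Graph rel_adj_sym rel_adj_irr u v -> crossing lefts rights u v.
Proof.
by case: u v => [i|j] [i'|j'] //=; rewrite /crossing !in_lefts !in_rights.
Qed.

Definition bigraph_of_rel : bigraph (I + J)%type :=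
  Bigraph lefts_rights_cover lefts_rights_disjoint rel_adj_crossing.

Lemma card_edges_of_rel :
  #|edges bigraph_of_rel| = \sum_j #|[set i | R i j]|.
Proof.
rewrite card_edges card_arcs /= big_imset /=; last by move=> ? ? _ _ [].
apply: eq_big => // j _; rewrite -(card_imset _ (@inl_inj I J)).
apply: eq_card => -[i|j']; rewrite inE /=; apply/idP/imsetP.
- by move=> Rij; exists i; rewrite ?inE.
- by case=> i'; rewrite inE => Rij [->].
- by [].
- by case.
Qed.

Lemma has_params_of_rel m : \sum_j #|[set i | R i j]| = m ->
  has_params bigraph_of_rel #|I| #|J| (#|I| + #|J|) m.
Proof.
move=> edges_m; split; last by rewrite card_edges_of_rel.
- by rewrite card_imset //; apply: inl_inj.
- by rewrite card_imset //; apply: inr_inj.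
- by rewrite card_sum.
Qed.

Lemma bcompl_of_relE i j : bcompl bigraph_of_rel (inl i) (inr j) = ~~ R i j.
Proof. by rewrite bcomplE /= ?in_lefts ?in_rights. Qed.

End BipartiteOfRelation.

(** * Intervals in Z/r, with r at least 2, and the connectivity they force *)

Section CyclicWindows.
Local Open Scope ring_scope.
Variable r' : nat.
Local Notation r := r'.+2.

(** This is the sumset of P and {-a, ..., -(a + d - 1)} in Z/r. *)
Definition window_hits (a d : nat) (P : {set 'I_r}) : {set 'I_r} :=
  [set j : 'I_r | [exists k : 'I_d, j + (a + k)%N%:R \in P]].

Lemma shift_closed_setT (T : {set 'I_r}) :
  T != set0 -> (forall j : 'I_r, j + 1 \in T -> j \in T) -> T = setT.
Proof.
case/set0Pn => i iT closedT; apply/setP => j; rewrite in_setT.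
suff shiftT k : i - k%:R \in T.
  by have := shiftT (nat_of_ord (i - j)); rewrite natr_Zp opprB addrC subrK.
elim: k => [|k IHk]; first by rewrite subr0.
by apply: closedT; rewrite -natr1 opprD addrA subrK.
Qed.

(** A Cauchy-Davenport bound for an interval, valid for composite r. Lengthening the intervals by
    one adjoins the translate of the set by -1; either the set grows, or it is closed under
    subtracting 1 and hence is all of Z/r. *)
Lemma card_window_hits (a d : nat) (P : {set 'I_r}) : P != set0 ->
  (minn r (#|P| + d) <= #|window_hits a d.+1 P|)%N.
Proof.
move=> P_neq0; elim: d => [|d IHd].
  rewrite addn0 (leq_trans (geq_minr _ _)) //.
  have add_inj : injective (fun j : 'I_r => j - a%:R) by apply: addIr.
  rewrite -(card_imset _ add_inj); apply/subset_leq_card/subsetP => _ /imsetP[i iP ->].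
  by rewrite inE; apply/existsP; exists ord0; rewrite addn0 subrK.
set T := window_hits a d.+1 P in IHd *.
have T_sub : T \subset window_hits a d.+2 P.
  apply/subsetP => j; rewrite !inE => /existsP[k jkP]; apply/existsP.
  by exists (widen_ord (leqnSn _) k).
have shift_sub j : j + 1 \in T -> j \in window_hits a d.+2 P.
  rewrite !inE => /existsP[k jkP]; apply/existsP; exists (lift ord0 k).
  by rewrite lift0 addnS -natr1 [X in j + X]addrC addrA.
have [T_eq|T_neq] := eqVneq (window_hits a d.+2 P) T; last first.
  have : (#|T| < #|window_hits a d.+2 P|)%N.
    by apply: proper_card; rewrite properEneq eq_sym T_neq.
  by move: IHd; rewrite !addnS; lia.
have : T = setT.
  apply: shift_closed_setT => [|j /shift_sub]; last by rewrite T_eq.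
  rewrite -card_gt0; apply: leq_trans IHd; rewrite leq_min /=.
  by rewrite addn_gt0 card_gt0 P_neq0.
by rewrite T_eq => ->; rewrite cardsT card_ord geq_minl.
Qed.

Lemma val_Zp_natr (k : nat) : (k < r)%N -> nat_of_ord (k%:R : 'I_r) = k.
Proof. by move=> ltkr; rewrite Zp_nat /= modn_small. Qed.

Lemma card_window (j : 'I_r) (L : nat) : (L <= r)%N ->
  #|[set i : 'I_r | ((i - j)%R < L)%N]| = L.
Proof.
move=> leLr; have add_inj : injective (fun k : 'I_r => k + j) by apply: addIr.
have -> : [set i : 'I_r | ((i - j)%R < L)%N] = [set k + j | k : 'I_r & (k < L)%N].
  apply/setP => i; rewrite inE; apply/idP/imsetP => [ltL|[k kL ->]].
    by exists (i - j); rewrite ?inE // subrK.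
  by move: kL; rewrite inE addrK.
by rewrite card_imset // cardsE -sum1_card (big_ord_narrow leLr) sum1_card card_ord.
Qed.

Section Windows.
Variables (s : nat) (H : graph ('I_r + 'I_s)%type) (a : nat).

(** The r - 1 vertices of Y from index [c] on link X into a path going once round Z/r, and every
    vertex of Y is attached to it. The offsets [a] and [c] are both 0 for the extremal graph, and q
    and t for its complement. *)
Lemma kappa_windows_gt0 (c : nat) :
  (c + r <= s + 1)%N ->
  (forall j : 'I_s, exists i : 'I_r, H (inl i) (inr j)) ->
  (forall j : 'I_s, (c <= j < c + r.-1)%N ->
     H (inl (j%:R + a%:R)) (inr j) /\ H (inl (j%:R + a%:R + 1)) (inr j)) ->
  (0 < kappa H)%N.
Proof.
move=> le_cs nbrH stepH; apply: connect_kappa_gt0.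
  by rewrite card_sum !card_ord.
have symH : connect_sym H by apply/sym_connect_sym/adj_sym.
have pathX k : (k < r)%N ->
    connect H (inl (c%:R + a%:R)) (inl ((c + k)%:R + a%:R)).
  elim: k => [|k IHk] ltkr; first by rewrite addn0.
  apply: connect_trans (IHk (ltnW ltkr)) _.
  have ltj : (c + k < s)%N by lia.
  have [|Hl Hr] := stepH (Ordinal ltj); first by rewrite /=; lia.
  apply: (@connect_trans _ _ (inr (Ordinal ltj))); first exact: connect1.
  rewrite symH; apply: connect1; move: Hr => /=.
  by rewrite addnS -natr1 addrAC.
have connX i : connect H (inl (c%:R + a%:R)) (inl i).
  have := pathX (i - (c%:R + a%:R)) (ltn_ord _).
  have -> : (c + (i - (c%:R + a%:R))%R)%:R + a%:R = i.
    by rewrite natrD natr_Zp addrAC addrC subrK.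
  by [].
have connV v : connect H (inl (c%:R + a%:R)) v.
  case: v => [i|j]; first exact: connX.
  by have [i Hij] := nbrH j; apply: connect_trans (connX i) (connect1 _).
by move=> u v; apply: connect_trans (connV v); rewrite symH.
Qed.

Hypothesis le_rs : (r <= s)%N.

(* False for d = 1: if s = r, windows of length 1 form a perfect matching. *)
Lemma kappa_windows (d : nat) : (2 <= d)%N -> (a + d <= r)%N ->
  (forall (i : 'I_r) (j : 'I_s),
     (a <= (i - j%:R)%R < a + d)%N -> H (inl i) (inr j)) ->
  (d <= kappa H)%N.
Proof.
move=> d_ge2 le_adr windowH; apply: kappa_ge.
  by rewrite card_sum !card_ord.
move=> S ltSd.
have window_adj (j : 'I_s) (k : nat) : (k < d)%N ->
    H (inl (j%:R + (a + k)%:R)) (inr j).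
  by move=> ltkd; apply: windowH; rewrite addrC addKr val_Zp_natr; lia.
have toX (v : 'I_r + 'I_s) : v \notin S ->
    exists2 i, inl i \notin S & connect (del H S) (inl i) v.
  case: v => [i iS|j jS]; first by exists i.
  pose f (k : 'I_d) : 'I_r := j%:R + (a + k)%:R.
  (* Since a + d <= r, the d positions do not wrap around, so [S], with fewer than d elements,
     misses a neighbour of y_j. *)
  have f_inj : injective f.
    move=> k1 k2 /addrI/(congr1 (@nat_of_ord r)).
    have := ltn_ord k1; have := ltn_ord k2 => lt2 lt1.
    by rewrite !val_Zp_natr; try lia; move/addnI/val_inj.
  have /subsetPn[_ /imsetP[k _ ->] kS] : ~~ ([set inl (f k) | k : 'I_d] \subset S).
    apply/negP => /subset_leq_card.
    rewrite card_imset ?card_ord 1?leqNgt ?ltSd //.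
    by apply: inj_comp f_inj; apply: inl_inj.
  exists (f k) => //; apply: connect1.
  by rewrite /del /= kS jS window_adj.
rewrite /separator negb_or; apply/andP; split; last first.
  have := cardsC S; rewrite card_sum !card_ord; move: ltSd le_rs le_adr.
  by move: #|_| #|_| => x y; lia.
apply/existsP => -[u]; rewrite inE => /andP[uS /existsP[v]]; rewrite inE => /andP[vS].
have [i1 i1S i1u] := toX u uS; have [i2 i2S i2v] := toX v vS.
move=> nuv; have ni12 : ~~ connect (del H S) (inl i1) (inl i2).
  apply: contra nuv => i12; apply: connect_trans i2v.
  by apply: connect_trans i12; rewrite connect_del_sym.
pose P := [set i | (inl i \notin S) && connect (del H S) (inl i1) (inl i)].
pose Q := [set i | (inl i \notin S) && ~~ connect (del H S) (inl i1) (inl i)].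
pose A := [set i : 'I_r | inl i \in S].
have card_PQA : (#|P| + #|Q| + #|A|)%N = r.
  rewrite -[RHS](card_ord r) -(cardsC A) addnC; congr (_ + _)%N.
  rewrite -(cardsID [set i | connect (del H S) (inl i1) (inl i)] (~: A)).
  by congr (_ + _)%N; apply: eq_card => i; rewrite !inE // andbC.
have P_neq0 : P != set0 by apply/set0Pn; exists i1; rewrite inE i1S connect0.
have Q_neq0 : Q != set0 by apply/set0Pn; exists i2; rewrite inE i2S.
pose B := window_hits a d P :&: window_hits a d Q.
(* Only the first r vertices of Y are used, so that the starting points run through Z/r exactly
   once. One whose interval meets both [P] and [Q] would join them unless deleted. *)
have cut : ([set inl i | i in A] :|: [set inr (widen_ord le_rs j) | j in B] \subset S).
  apply/subsetP => w; rewrite inE => /orP[] /imsetP[x]; first by rewrite inE => xS ->.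
  rewrite !inE => /andP[/existsP[k kP] /existsP[l lQ]] ->; apply: contraT => xS.
  move: kP lQ; rewrite !inE => /andP[kS ck] /andP[lS /negP[]].
  apply: connect_trans ck _; set y := inr _ in xS.
  have xE : x = (widen_ord le_rs x)%:R by rewrite /= natr_Zp.
  apply: (@connect_trans _ _ y); last rewrite connect_del_sym;
    apply: connect1; rewrite /del /= ?kS ?lS xS /= {1}xE window_adj //.
have card_cut : (#|A| + #|B| <= #|S|)%N.
  apply: leq_trans (subset_leq_card cut).
  rewrite cardsU disjoint_setI0 ?cards0 ?subn0.
    rewrite !card_imset //; first by move=> x y [/val_inj].
    exact: inl_inj.
  by apply/pred0P => -[x|x] /=; apply/negP => /andP[/imsetP[? _ ?] /imsetP[]].
(* If both minima are below r, inclusion-exclusion gives |A| + |B| >= 2d - 2, which is at least d as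
   d >= 2. If one minimum is r, then already |B| >= d, because the other set is nonempty. *)
have := card_window_hits a d.-1 P_neq0; have := card_window_hits a d.-1 Q_neq0.
rewrite prednK; last by lia.
have := cardsUI (window_hits a d P) (window_hits a d Q); rewrite -/B.
have := max_card (mem (window_hits a d P :|: window_hits a d Q)); rewrite card_ord.
move: P_neq0 Q_neq0 card_PQA card_cut ltSd; rewrite -!card_gt0.
move: #|P| #|Q| #|A| #|B| #|S| #|_ :|: _| #|window_hits a d P| #|window_hits a d Q|.
lia.
Qed.

End Windows.
End CyclicWindows.

(** * Bounds on both connectivities in terms of m = qs + t *)

Lemma kappa_bounds (V : finType) (G : bigraph V) (r s n m : nat) :
  has_params G r s n m -> r <= s -> 0 < s ->
  [/\ kappa G <= m %/ s, kappa (bcompl G) + m %/ s + (0 < m %% s) <= r,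
      m + 2 <= n -> kappa G = 0 & r - m <= kappa (bcompl G)].
Proof.
case=> cardX cardY cardV cardE le_rs s_gt0; split.
- by have := kappa_mul_le G; rewrite cardY cardE leq_divRL.
(* The complement has rs - m edges. The term [0 < m %% s] rounds m/s up to its ceiling. *)
- have : kappa (bcompl G) * #|partY G| <= #|edges (bcompl G)| := kappa_mul_le (bcompl G).
  have := card_edges_bcompl G; rewrite cardX cardY cardE {1}(divn_eq m s).
  move: #|_| => e; move: (ltn_pmod m s_gt0).
  by case: (m %% s) => [|t] /=; nia.
- by rewrite -cardE -cardV; apply: kappa_eq0.
- by rewrite -cardE -cardX; apply: kappa_bcompl_ge; rewrite cardX cardY.
Qed.

(** * A graph attaining both lower bounds *)

Section FillingExample.
Variables (r s m : nat).

(* The edges fill the neighbourhoods of y_0, y_1, ... one after the other, so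
   the last vertex of Y is isolated if m <= r (s - 1). *)
Definition fill_rel (i : 'I_r) (j : 'I_s) := j * r + i < m.

Lemma card_ord_lt (L : nat) : #|[set i : 'I_r | i < L]| = minn r L.
Proof.
have [leLr|ltrL] := leqP L r.
  by rewrite cardsE -sum1_card (big_ord_narrow leLr) sum1_card card_ord.
rewrite -[RHS](card_ord r); apply: eq_card => i; rewrite !inE.
exact: ltn_trans (ltn_ord i) ltrL.
Qed.

(** The first s - 1 vertices of Y have room for all m edges, so the last one is isolated. In the
    complement the first one keeps r - m neighbours, where truncation supplies the maximum with
    0. *)
Lemma fill_example : 0 < s -> m <= r * s.-1 ->
  exists (V : finType) (G : bigraph V),
    [/\ has_params G r s (r + s) m, kappa G = 0 & kappa (bcompl G) <= r - m].
Proof.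
move=> s_gt0 le_m; exists ('I_r + 'I_s)%type, (bigraph_of_rel fill_rel).
have ltl : s.-1 < s by rewrite prednK.
split.
- have -> : has_params (bigraph_of_rel fill_rel) r s (r + s) m =
    has_params (bigraph_of_rel fill_rel) #|'I_r| #|'I_s| (#|'I_r| + #|'I_s|) m.
    by rewrite !card_ord.
  apply: has_params_of_rel.
  transitivity (\sum_(j < s) minn r (m - j * r)).
    apply: eq_bigr => j _; rewrite -card_ord_lt; apply: eq_card => i.
    by rewrite !inE /fill_rel; lia.
  have -> : \sum_(j < s) minn r (m - j * r) = minn (s * r) m.
    elim: (s) => [|k IHk]; first by rewrite big_ord0 min0n.
    by rewrite big_ord_recr /= IHk mulSn; lia.
  by apply/minn_idPr; nia.
- apply/eqP; rewrite -leqn0.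
  apply: leq_trans (kappa_le_degree _ (inr (Ordinal ltl))) _.
  rewrite leqn0 cards_eq0; apply/eqP/setP => -[i|j]; rewrite !inE //=.
  by rewrite /fill_rel /=; nia.
- apply: leq_trans (kappa_le_degree _ (inr (Ordinal s_gt0))) _.
  have -> : r - m = #|~: [set i : 'I_r | i < m]|.
    by have := cardsC [set i : 'I_r | i < m]; rewrite card_ord_lt card_ord; lia.
  rewrite -(card_imset _ (@inl_inj 'I_r 'I_s)); apply/subset_leq_card/subsetP => -[i|j].
    rewrite inE bcompl_of_relE /fill_rel /= mul0n add0n => nim.
    by apply/imsetP; exists i; rewrite ?inE.
  by rewrite inE /= /bc_adj /crossing /= !in_lefts !in_rights.
Qed.

End FillingExample.

(** * The extremal graphs for the upper bounds *)

Section WindowExample.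
Local Open Scope ring_scope.
Variables (r' s q t : nat).
Local Notation r := r'.+2.
Hypothesis le_rs : (r <= s)%N.
Hypothesis lt_ts : (t < s)%N.

Definition window_rel (i : 'I_r) (j : 'I_s) : bool :=
  ((i - j%:R)%R < q + (j < t))%N.

Local Notation G := (bigraph_of_rel window_rel).

Lemma has_params_window : (q + (0 < t) <= r)%N ->
  has_params G r s (r + s) (q * s + t).
Proof.
move=> le_qr.
have -> : has_params G r s (r + s) (q * s + t) =
    has_params G #|'I_r| #|'I_s| (#|'I_r| + #|'I_s|) (q * s + t).
  by rewrite !card_ord.
apply: has_params_of_rel.
transitivity (\sum_(j < s) (q + (j < t)))%N.
  apply: eq_bigr => j _; rewrite /window_rel card_window //.
  by apply: leq_trans le_qr; rewrite leq_add2l; case: t => // k; case: ltnP.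
rewrite big_split /= sum_nat_const card_ord mulnC; congr (_ + _)%N.
by rewrite -big_mkcond /= (big_ord_narrow (ltnW lt_ts)) sum1_card card_ord.
Qed.

(** Every neighbourhood contains an interval of length q. For q = 1 the condition on t makes the
    first r - 1 intervals have length 2. *)
Lemma kappa_window_ge : (q <= r)%N -> (q = 1%N -> r <= t + 1)%N -> (q <= kappa G)%N.
Proof.
move=> le_qr le_t; case: (ltngtP q 1%N) => [|q_gt1|q1]; first by case: (q).
  apply: (@kappa_windows _ _ _ 0%N) => // i j /=.
  by rewrite /window_rel add0n => lt_q; apply: leq_trans lt_q (leq_addr _ _).
rewrite q1; apply: (@kappa_windows_gt0 _ _ _ 0%N 0%N).
- by rewrite add0n (leq_trans le_rs) ?leq_addr.
- by move=> j; exists j%:R; rewrite /= /window_rel subrr q1.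
- move=> j; rewrite add0n /= => lt_j; rewrite /window_rel addr0 subrr q1.
  have -> : (j < t)%N by have := le_t q1; lia.
  by rewrite addrC addKr.
Qed.

(** Relative to j, the positions from q + (0 < t) to r - 1 are complementary neighbours of every
    y_j. If this is only the position r - 1, the vertices y_j with j >= t also have position q = r -
    2, and r - 1 of them are available. *)
Lemma kappa_bcompl_window_ge :
  (r = q + (0 < t) + 1 -> 0 < t /\ r + t <= s + 1)%N ->
  (r - (q + (0 < t)) <= kappa (bcompl G))%N.
Proof.
move=> r_eq; have lt_jt (j : 'I_s) : ((j < t) <= (0 < t))%N.
  by case: t => //= k; case: ltnP.
case: (ltngtP (r - (q + (0 < t)))%N 1%N) => [|d_gt1|d_eq1]; first by case: (r - _)%N.
  apply: (@kappa_windows _ _ _ (q + (0 < t))%N) => //; first lia.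
  move=> i j /andP[le_ij _]; rewrite bcompl_of_relE -leqNgt.
  by apply: leq_trans le_ij; rewrite leq_add2l.
have [t_gt0 le_rt] : (0 < t /\ r + t <= s + 1)%N by apply: r_eq; lia.
rewrite d_eq1; apply: (@kappa_windows_gt0 _ _ _ q t).
- by rewrite addnC.
- move=> j; exists (j%:R + r'.+1%:R); rewrite bcompl_of_relE /window_rel.
  by rewrite addrC addKr val_Zp_natr // -leqNgt; have := lt_jt j; lia.
- move=> j /andP[le_tj _]; rewrite !bcompl_of_relE /window_rel -!leqNgt.
  rewrite (ltnNge j t) le_tj addn0 -[_ + _ + 1]addrA natr1.
  have subK (k : 'I_r) : j%:R + k - j%:R = k by rewrite addrC addKr.
  by rewrite !subK !val_Zp_natr; lia.
Qed.

End WindowExample.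

(** The case q = 1 in G is harmless: m >= n - 1 then gives t >= r - 1. In the excluded case both
    graphs would have all intervals of length 1. *)
Lemma window_example (r s m : nat) : 2 <= r -> r <= s -> 2 * m <= r * s ->
  ~ (r = 2 /\ m = s) ->
  exists (V : finType) (G : bigraph V),
    [/\ has_params G r s (r + s) m, r + s <= m + 1 -> m %/ s <= kappa G &
        r - (m %/ s + (0 < m %% s)) <= kappa (bcompl G)].
Proof.
case: r => [|[|r']] // _ le_rs le_m not2s.
have s_gt0 : 0 < s by lia.
have lt_t : m %% s < s by rewrite ltn_mod.
have m_eq := divn_eq m s.
exists ('I_r'.+2 + 'I_s)%type.
exists (bigraph_of_rel (@window_rel r' s (m %/ s) (m %% s))).
move: m_eq lt_t; move: (m %/ s) (m %% s) => q t m_eq lt_t.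
have le_q : 2 * q <= r'.+2 by nia.
have le_qt : q + (0 < t) <= r'.+2 by case: t m_eq lt_t => [|t] /=; lia.
split; first by rewrite m_eq; apply: has_params_window.
- move=> le_m1; apply: kappa_window_ge => //; first by lia.
  by move=> q1; move: m_eq; rewrite q1; lia.
- apply: kappa_bcompl_window_ge => //.
  case: t m_eq lt_t le_qt => [|t] /= m_eq lt_t le_qt r_eq.
    (* With t = 0, r = q + 1 and 2q <= r leave only q = 1, r = 2, that is m = s. *)
    have r'0 : r' = 0 by lia.
    case: not2s; subst r'; have q1 : q = 1 by [lia]; subst q; split; lia.
  split=> //.
  (* Now r = q + 2, so 2m <= rs and a positive remainder give qs < 2s. *)
  have q_le1 : q <= 1 by nia.
  have [q0|q1] : q = 0 \/ q = 1 by lia.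
    by subst q; lia.
  by subst q; have r'1 : r' = 1 by [lia]; subst r'; lia.
Qed.

(** * N and M in terms of quotient and remainder *)

Section BoundFormulas.
Local Open Scope ring_scope.
Variables (r s m : nat).
Hypotheses (s_gt0 : (0 < s)%N) (le_rs : (r <= s)%N) (le_m : (2 * m <= r * s)%N).

(** The right side is the sum of the upper bounds for the two connectivities. For m >= n - 1 the
    quotient cancels; for m <= n - 2 the ceiling of m/s is at most 2, since n - 2 < 2s. *)
Lemma NboundE :
  Nbound r s (r + s) m =
  (r - ((if (m + 2 <= r + s)%N then m %/ s else 0) + (0 < m %% s)))%N%:R.
Proof.
have m_eq := divn_eq m s; have lt_t : (m %% s < s)%N by rewrite ltn_mod.
rewrite /Nbound mod0n -lt0n.
move: m_eq lt_t; move: (m %/ s)%N (m %% s)%N => q' t m_eq lt_t.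
case: (leqP (m + 2) (r + s)) => [le_mn|lt_nm].
  have [le_sm|lt_ms] /= := leqP (s + 1) m.
    have q1 : q' = 1%N by nia.
    have t_gt0 : (0 < t)%N by subst q'; lia.
    by rewrite t_gt0 q1 natrB //; lia.
  have [m0|m_gt0] := posnP m.
    have [-> ->] : q' = 0%N /\ t = 0%N by nia.
    rewrite m0 /= subn0 addn1; case: ifP => //; lia.
  have -> : (q' + (0 < t)%N = 1)%N.
    by case: t m_eq lt_t => [|t] /= m_eq lt_t; nia.
  by rewrite ifT ?natrB //; nia.
rewrite andbF add0n.
have [t0|t_gt0] := posnP t.
  rewrite ifF ?t0 ?subn0 //=; apply/negbTE; rewrite !negb_or /=.
  have [r0|r_gt0] := posnP r.
    by have m0 : m = 0%N by [move: le_m; rewrite r0; lia]; rewrite r0 m0 andbF.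
  have r_neq1 : r <> 1%N by move=> r1; move: le_m; rewrite r1; lia.
  (* If m = qs were n - 1, then r = (q - 1)s + 1, contradicting 1 < r <= s. *)
  have : m <> (r + s - 1)%N by case: q' m_eq => [|[|k]]; nia.
  lia.
have r_gt1 : (1 < r)%N.
  by case: r le_m le_rs lt_nm => [|[|k]] // le_m' *; lia.
by rewrite ifT ?natrB //; lia.
Qed.

(** Here the same two upper bounds are multiplied. *)
Lemma MboundE :
  Mbound r s (r + s) m =
  (if (m + 2 <= r + s)%N then 0
   else (m %/ s) * (r - (m %/ s + (0 < m %% s))))%N%:R.
Proof.
have m_eq := divn_eq m s; have lt_t : (m %% s < s)%N by rewrite ltn_mod.
rewrite /Mbound mod0n.
case: (leqP (m + 2) (r + s)) => [le_mn|lt_nm] //=.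
have r_neq1 : r != 1%N by apply/eqP => r1; subst r; lia.
rewrite (negbTE r_neq1) andbF.
have [t0|t_gt0] := posnP (m %% s).
  have mE : m%:R / s%:R = (m %/ s)%N%:R :> rat.
    by rewrite {1}m_eq t0 addn0 natrM mulfK // pnatr_eq0 -lt0n.
  rewrite mE /= addn0 natrM.
  have le_q : (m %/ s <= r)%N by nia.
  case: leqP => [le_nm|lt_mn] /=; first by rewrite natrB.
  (* Here m = n - 1 is a multiple of s, which forces m = 0. *)
  suff -> : (m %/ s = 0)%N by rewrite !mul0r.
  have [r0|r_gt0] := posnP r.
    by have -> : m = 0%N by [move: le_m; rewrite r0; lia]; rewrite div0n.
  move: m_eq; rewrite t0; move: (m %/ s)%N => [//|[|k]]; nia.
rewrite /= natrM natrB; last by nia.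
by rewrite natrD opprD [- _ - 1]addrC addrA.
Qed.

End BoundFormulas.

(** * The bounds and their sharpness *)

Local Open Scope ring_scope.

Theorem theorem4p3 (r s n m : nat) (n_gt0 : (0 < n)%N) (n_def : n = (r + s)%N)
    (le_rs : (r <= s)%N) (le_m : m%:R <= 1 / 2 * (r%:R * s%:R) :> rat) :
  (forall (V : finType) (G : bigraph V), has_params G r s n m ->
     (Num.max 0 (r%:R - m%:R) <= (kappa G)%:R + (kappa (bcompl G))%:R :> rat
      /\ (kappa G)%:R + (kappa (bcompl G))%:R <= Nbound r s n m)
     /\ (0 <= (kappa G)%:R * (kappa (bcompl G))%:R :> rat
         /\ (kappa G)%:R * (kappa (bcompl G))%:R <= Mbound r s n m))
  /\ (exists (V : finType) (G : bigraph V), has_params G r s n m /\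
        (kappa G)%:R + (kappa (bcompl G))%:R = Num.max 0 (r%:R - m%:R) :> rat)
  /\ (~ (r = 2%N /\ m = s) ->
      exists (V : finType) (G : bigraph V), has_params G r s n m /\
        (kappa G)%:R + (kappa (bcompl G))%:R = Nbound r s n m)
  /\ (exists (V : finType) (G : bigraph V), has_params G r s n m /\
        (kappa G)%:R * (kappa (bcompl G))%:R = 0 :> rat)
  /\ (exists (V : finType) (G : bigraph V), has_params G r s n m /\
        (kappa G)%:R * (kappa (bcompl G))%:R = Mbound r s n m).
Proof.
have s_gt0 : (0 < s)%N by lia.
have {}le_m : (2 * m <= r * s)%N.
  by rewrite -(ler_nat rat) !natrM; move: le_m; lra.
have maxE : Num.max 0 (r%:R - m%:R) = (r - m)%N%:R :> rat.
  have [le_mr|lt_rm] := leqP m r.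
    by rewrite natrB // max_r // subr_ge0 ler_nat.
  by rewrite (eqP (ltnW lt_rm)) max_l // subr_le0 ler_nat ltnW.
subst n; rewrite maxE NboundE // MboundE //; clear maxE.
have bounds (V : finType) (G : bigraph V) (hG : has_params G r s (r + s) m) :=
  kappa_bounds hG le_rs s_gt0.
have [V0 [G0 [hG0 kG0 kbG0]]] : exists (V : finType) (G : bigraph V),
    [/\ has_params G r s (r + s) m, kappa G = 0%N & (kappa (bcompl G) <= r - m)%N].
  (* If s >= 2 then s - 1 >= s/2, and if s = 1 then m = 0. *)
  by apply: fill_example => //; nia.
have [_ le_q _ ge_kbG0] := bounds _ _ hG0.
split.
  move=> V G /bounds[le1 le2 disc ge2]; rewrite -!natrD -!natrM !ler_nat.
  move: (kappa G) (kappa (bcompl G)) le1 le2 disc ge2 => k1 k2 le1 le2 disc ge2.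
  split; split=> //; first by lia.
  - by have [/disc->|_] := leqP (m + 2) (r + s); lia.
  - by have [/disc->|_] := leqP (m + 2) (r + s); rewrite ?leq_mul //; lia.
split; first by exists V0, G0; rewrite kG0 add0r; split=> //; congr _%:R; lia.
have prod0 : exists (V : finType) (G : bigraph V), has_params G r s (r + s) m /\
        (kappa G)%:R * (kappa (bcompl G))%:R = 0 :> rat.
  by exists V0, G0; rewrite kG0 mul0r.
split.
  move=> not2s; have [r_le1|r_gt1] := leqP r 1.
    (* For r <= 1 the lower and upper bounds coincide: q = 0 and r - (0 < m) = r - m. *)
    exists V0, G0; split=> //; rewrite -natrD; congr _%:R.
    have lt_ms : (m < s)%N by nia.
    move: (kappa G0) (kappa (bcompl G0)) kG0 kbG0 ge_kbG0 => k1 k2 -> *.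
    by rewrite divn_small // modn_small // if_same; lia.
  have [V [G [hG ge1 ge2]]] := window_example r_gt1 le_rs le_m not2s.
  exists V, G; split=> //; rewrite -natrD; congr _%:R.
  have [le1 le2 disc _] := bounds _ _ hG.
  move: (kappa G) (kappa (bcompl G)) le1 le2 disc ge1 ge2 => k1 k2 le1 le2 disc ge1 ge2.
  by have [/disc|] := leqP (m + 2) (r + s); lia.
split=> //.
have [le_mn|lt_nm] := leqP (m + 2) (r + s); first by [].
(* With m >= n - 1, the case r <= 1 leaves only r = m = 0 and s = 1, where the product is 0. *)
have [r_le1|r_gt1] := leqP r 1.
  by rewrite divn_small //; nia.
(* The exceptional pair has m = n - 2, below the present range. *)
have not2s : ~ (r = 2%N /\ m = s) by lia.
have [V [G [hG ge1 ge2]]] := window_example r_gt1 le_rs le_m not2s.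
exists V, G; split=> //; rewrite -natrM; congr _%:R.
have [le1 le2 disc _] := bounds _ _ hG.
by congr (_ * _)%N; lia.
Qed.
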